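(* For $n\ge 1$, let $f_0(n)$ be the number of binary words (over $\{0,1\}$) of length $n-1$ in which $0$ and $1$ appear only as subwords of the form $1i$, where $i$ is a run of zeros of length at least $1$. For $1\le k\le n$ let $$c_1(n,k)=\sum_{i_1+i_2+\cdots+i_k=n}f_0(i_1)f_0(i_2)\cdots f_0(i_k),$$ the sum being over positive integers $i_1,\ldots,i_k$. Then $c_1(k,k)=1$ for $k\geq 1$, and for $n>k\ge 1$, $$c_1(n,k)=\sum_{i=1}^k\sum_{j=i}^{\left\lfloor\frac{n-k}{2}\right\rfloor}\binom{k}{i}\binom{j-1}{i-1}\binom{n-k-j-1}{j-1}.$$
   Context: The condition on words means that the word is a (possibly empty) concatenation of blocks of the form $10^j$ with $j\ge 1$. Equivalently $f_0(1)=1$ and $f_0(n)=F_{n-2}$ for $n>1$, where $F_n$ are the Fibonacci numbers with $F_0=0$, $F_1=1$. Sums whose upper limit is smaller than the lower limit are $0$. *)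

(* Defs.v *)
From mathcomp Require Import all_boot.
From mathcomp Require Import boolp.

Set Implicit Arguments.
Unset Strict Implicit.
Unset Printing Implicit Defensive.

(* Binary letters are booleans: true is the letter 1, false the letter 0. *)
Definition block (j : nat) : seq bool := true :: nseq j false.

Definition block_word (w : seq bool) : Prop :=
  exists js : seq nat, all (fun j => 1 <= j) js /\ w = flatten (map block js).

(* Only meaningful for n >= 1, because of n.-1. *)
Definition f0 (n : nat) : nat :=
  #|[set w : n.-1.-tuple bool | `[< block_word w >]]|.

(* The parts i_1, ..., i_k of a composition of n are at most n, hence the
   (finite) codomain 'I_n.+1. *)
Definition c1 (n k : nat) : nat :=
  \sum_(p : {ffun 'I_k -> 'I_n.+1} |
          [forall l, 1 <= p l] && (\sum_(l < k) p l == n))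
     \prod_(l < k) f0 (p l).

(* Main.v *)
Require Import Defs.
From mathcomp Require Import all_boot.
From mathcomp Require Import ssralg poly boolp zify.

Import GRing.Theory.

(** Let a block be a word [10^j] with [j >= 1].  Since [f0 n] counts block words
    of length [n - 1], [c1 (m + k) k] counts the [k]-tuples of block words of
    total length [m].  Such a tuple is a single block word of length [m], with
    some number [j] of blocks, cut between blocks into [k] possibly empty
    pieces.  There are ['C(k + j - 1, j)] ways to cut, and block words of length
    [m] with [j] blocks are the compositions of [m] into [j] parts at least 2,
    of which there are ['C(m - j - 1, j - 1)] when [1 <= j <= m / 2].
    Vandermonde's identity splits ['C(k + j - 1, j)] according to the number [i]
    of nonempty pieces, which gives the double sum.

    The identity [c1 (m + k) k = cut_count k m] ([c1_cut_count]) is proved with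
    generating functions in [m].  If [P] is the series of block words by length,
    then [c1 n k] is the coefficient of [X^n] in [(X P)^k] ([c1_coef_exp]), where
    [P] can be truncated to a polynomial.
    The word recurrence [f0_rec] means [(1 - X - X^2) P = 1 - X], and
    [cut_count_rec] means [(1 - X - X^2) R_(k+1) = (1 - X) R_k] for the series
    [R_k] of [cut_count k]; hence [R_(k+1) = P R_k] ([cut_count_conv]). *)

(** * Counting block words *)

Lemma block_word_nil : block_word [::].
Proof. by exists [::]. Qed.

Lemma block_word_false w : ~ block_word (false :: w).
Proof. by case=> -[|j js] []. Qed.

Lemma block_word_true : ~ block_word [:: true].
Proof. by case=> -[|[|j] js] []. Qed.

Lemma block_word_true_true w : ~ block_word [:: true, true & w].
Proof. by case=> -[|[|j] js] []. Qed.

Lemma block_word_true_false : block_word [:: true; false].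
Proof. by exists [:: 1]. Qed.

Lemma block_word_true_false_true w :
  block_word [:: true, false, true & w] <-> block_word (true :: w).
Proof.
split=> [[[|[|[|j]] js] [//= js_gt0 [->]]]|[js [js_gt0 ->]]].
  by exists js.
by exists (1 :: js).
Qed.

Lemma block_word_true_false_false w :
  block_word [:: true, false, false & w] <-> block_word [:: true, false & w].
Proof.
split=> [[[|[|[|j]] js] [//= js_gt0 []]]|[[|[|j] js] [//= js_gt0 [->]]]].
- by case: js js_gt0.
- by move=> ->; exists (j.+1 :: js).
- by exists (j.+2 :: js).
Qed.

Definition word_count n (P : seq bool -> Prop) :=
  #|[set w : n.-tuple bool | `[< P w >]]|.

Lemma eq_word_count n P Q :
  (forall w, P w <-> Q w) -> word_count n P = word_count n Q.
Proof. by move=> eqPQ; apply: eq_card => w; rewrite !inE; apply: asbool_equiv_eq. Qed.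

Lemma word_count_none n P : (forall w, ~ P w) -> word_count n P = 0.
Proof.
by move=> nP; apply: eq_card0 => w; rewrite inE; apply/asboolPn/nP.
Qed.

Lemma word_count0 P : word_count 0 P = `[< P [::] >].
Proof.
rewrite /word_count; case: asboolP => [Pnil|nPnil].
  transitivity #|{: 0.-tuple bool}|; last by rewrite card_tuple.
  by apply: eq_card => w; rewrite !inE tuple0; apply/asboolP.
by apply: eq_card0 => w; rewrite inE tuple0; apply/asboolPn.
Qed.

Lemma word_countS n P :
  word_count n.+1 P =
  word_count n (fun w => P (true :: w)) + word_count n (fun w => P (false :: w)).
Proof.
have cons_inj b : injective (fun w : n.-tuple bool => [tuple of b :: w]).
  by move=> u v /(congr1 val) [] /val_inj.
rewrite /word_count -(card_imset _ (cons_inj true)) -(card_imset _ (cons_inj false)).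
rewrite -cardsUI (_ : _ :&: _ = set0) ?cards0 ?addn0; last first.
  apply/setP=> w; rewrite !inE; apply/negP => /andP[] /imsetP[u _ ->].
  by case/imsetP=> v _ /(congr1 val).
apply: eq_card => w; rewrite !inE; case/tupleP: w => b w.
apply/asboolP/orP => [Pw|[] /imsetP[u]].
- by case: b Pw => Pw; [left|right]; apply/imsetP; exists w => //; rewrite inE; apply/asboolP.
- by rewrite inE => /asboolP Pu ->.
- by rewrite inE => /asboolP Pu ->.
Qed.

Lemma f01 : f0 1 = 1.
Proof. by rewrite [LHS]word_count0 (asboolT block_word_nil). Qed.

Lemma f0_prefix1 n : f0 n.+2 = word_count n (fun w => block_word (true :: w)).
Proof.
rewrite [LHS]word_countS [X in _ + X]word_count_none ?addn0 //.
exact: block_word_false.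
Qed.

Lemma f0_prefix10 n :
  f0 n.+3 = word_count n (fun w => block_word [:: true, false & w]).
Proof.
rewrite f0_prefix1 word_countS [X in X + _]word_count_none //.
exact: block_word_true_true.
Qed.

Lemma f02 : f0 2 = 0.
Proof. by rewrite f0_prefix1 word_count0 (asboolF block_word_true). Qed.

(** A block word of length [n + 2] starts with [100] or with [10] followed by a
    block word: delete a [0] from the first block, or delete the whole block. *)
Lemma f0_rec n : f0 n.+3 = f0 n.+2 + f0 n.+1.
Proof.
case: n => [|n].
  by rewrite f02 f01 f0_prefix10 word_count0 (asboolT block_word_true_false).
rewrite f0_prefix10 word_countS addnC f0_prefix10 f0_prefix1.
congr (_ + _); apply: eq_word_count => w.
  exact: block_word_true_false_false.
exact: block_word_true_false_true.
Qed.

(** * Compositions into parts at least 2, and their cuttings *)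

(** The number of compositions of [m] into [j] parts at least 2; in the
    recursive case the last part is decreased by 1, or removed if it is 2. *)
Fixpoint comp2 m j :=
  match m, j with
  | 0, _ => j == 0 : nat
  | (m'.+1 as m1).+1, j'.+1 => comp2 m1 j + comp2 m' j'
  | _, _ => 0
  end.

Lemma comp2SS m j : comp2 m.+2 j.+1 = comp2 m.+1 j.+1 + comp2 m j.
Proof. by []. Qed.

Lemma comp2_large m j : m < j.*2 -> comp2 m j = 0.
Proof.
elim/ltn_ind: m j => -[|[|m]] IH [|j] // lt_mj.
by rewrite comp2SS !IH //; lia.
Qed.

Lemma comp2_bin m j : 0 < j -> j.*2 <= m -> comp2 m j = 'C(m - j - 1, j - 1).
Proof.
elim/ltn_ind: m j => -[|[|m]] IH [|j] // _ le_jm.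
rewrite comp2SS; case: j le_jm => [|j] le_jm.
  case: m IH le_jm => [|m] IH _ //.
  by rewrite IH // [comp2 m.+1 0]/= !bin0; case: m {IH}.
rewrite (IH m) //.
have -> : m.+2 - j.+2 - 1 = (m - j.+1 - 1).+1 by lia.
have [lt_jm|ge_jm] := leqP j.+2.*2 m.+1.
  rewrite (IH m.+1) //; have -> : m.+1 - j.+2 - 1 = m - j.+1 - 1 by lia.
  by rewrite !subn1 /= binS.
rewrite comp2_large // add0n; have -> : m - j.+1 - 1 = j by lia.
by rewrite !subn1 /= !binn.
Qed.

(** The number of ways to cut a sequence of [j] blocks of total length [m] into
    [k] possibly empty pieces.  For [k = j = 0] the truncated subtraction gives
    the right value 1. *)
Definition cut_count k m := \sum_(j < m.+1) 'C(k + j - 1, j) * comp2 m j.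

Lemma cut_count0n m : cut_count 0 m = (m == 0).
Proof.
rewrite /cut_count big_ord_recl big1 => [|j _]; last first.
  by rewrite lift0 bin_small //; lia.
by case: m => [|[|m]].
Qed.

Lemma cut_countn0 k : cut_count k 0 = 1.
Proof. by rewrite /cut_count big_ord1 bin0. Qed.

Lemma cut_countn1 k : cut_count k 1 = 0.
Proof. by rewrite /cut_count !big_ord_recl big_ord0 /= !muln0. Qed.

(** Pascal's rule on ['C(k + j, j)]: the last of [k + 1] pieces is empty, or it
    ends with the last block of the sequence. *)
Lemma cut_countS k m :
  cut_count k.+1 m = cut_count k m + \sum_(j < m) 'C(k + j.+1 - 1, j) * comp2 m j.+1.
Proof.
rewrite /cut_count !big_ord_recl !bin0 -addnA -big_split; congr (_ + _).
apply: eq_bigr => j _; rewrite lift0 !addnS !subn1 addSn binS.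
exact: mulnDl.
Qed.

(** With [R_k] the generating series of [cut_count k], this says that
    [(1 - X - X^2) R_(k+1) = (1 - X) R_k]. *)
Lemma cut_count_rec k m :
  cut_count k.+1 m.+2 + cut_count k m.+1 =
  cut_count k m.+2 + cut_count k.+1 m.+1 + cut_count k.+1 m.
Proof.
rewrite !(cut_countS k m.+2) (cut_countS k m.+1).
suff -> : \sum_(j < m.+2) 'C(k + j.+1 - 1, j) * comp2 m.+2 j.+1 =
  \sum_(j < m.+1) 'C(k + j.+1 - 1, j) * comp2 m.+1 j.+1 + cut_count k.+1 m by lia.
rewrite /cut_count -big_split big_ord_recr.
rewrite (comp2_large m.+2 ord_max.+1) ?muln0 ?addn0; last by rewrite /=; lia.
rewrite [LHS]addn0; apply: eq_bigr => j _.
by rewrite comp2SS mulnDr addSnnS.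
Qed.

(** Splitting off the first piece.  Both sides satisfy the same linear
    recurrence in [m]. *)
Lemma cut_count_conv k m :
  \sum_(a < m.+1) f0 a.+1 * cut_count k (m - a) = cut_count k.+1 m.
Proof.
elim/ltn_ind: m => -[|[|m]] IH.
- by rewrite big_ord1 f01 !cut_countn0.
- by rewrite !big_ord_recl big_ord0 f01 f02 !cut_countn1.
have peel1 : \sum_(a < m.+2) f0 a.+1 * cut_count k (m.+1 - a) =
    cut_count k m.+1 + \sum_(a < m.+1) f0 a.+2 * cut_count k (m - a).
  by rewrite big_ord_recl f01 mul1n.
have peel2 : \sum_(a < m.+3) f0 a.+1 * cut_count k (m.+2 - a) =
    cut_count k m.+2 + \sum_(a < m.+1) f0 a.+3 * cut_count k (m - a).
  by rewrite !big_ord_recl f01 f02 mul1n mul0n.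
have shift : \sum_(a < m.+1) f0 a.+3 * cut_count k (m - a) =
    \sum_(a < m.+1) f0 a.+2 * cut_count k (m - a) + cut_count k.+1 m.
  rewrite -(IH m) // -big_split; apply: eq_bigr => a _.
  by rewrite f0_rec mulnDl.
by have := cut_count_rec k m; rewrite -(IH m.+1) //; lia.
Qed.

(** * The generating function of block words *)

(** The generating series of block words by length, cut off below degree [N];
    its powers are correct below degree [N] as well. *)
Definition word_poly N : {poly nat} := (\poly_(a < N) f0 a.+1)%R.

Lemma coef_word_poly_exp N k m :
  m < N -> ((word_poly N ^+ k)%R`_m)%R = cut_count k m.
Proof.
elim: k m => [|k IHk] m lt_mN; first by rewrite expr0 coef1 cut_count0n natn.
rewrite exprS coefM -cut_count_conv; apply: eq_bigr => a _.
by rewrite coef_poly IHk ?(leq_ltn_trans (leq_ord a)) ?(leq_ltn_trans (leq_subr a m)).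
Qed.

(** Expanding the [k]-th power of [X * word_poly n] gives one monomial for every
    choice of [k] positive parts, and the degree is their sum. *)
Lemma c1_coef_exp n k : c1 n k = ((('X * word_poly n) ^+ k)%R`_n)%R.
Proof.
have -> : ('X * word_poly n = \sum_(i < n.+1 | (0 < i)%N) (f0 i)%:P * 'X^i :> {poly nat})%R.
  rewrite big_mkcond big_ord_recl /= add0r /word_poly poly_def mulr_sumr.
  by apply: eq_bigr => i _; rewrite -mul_polyC mulrCA -exprS.
rewrite -[in RHS](card_ord k) -prodr_const.
rewrite (bigA_distr_big (fun i : 'I_n.+1 => 0 < i)) coef_sum /c1.
rewrite big_mkcondr; apply: eq_big => [p|p _].
  by apply/idP/idP => [/forallP p_gt0|/ffun_onP p_gt0]; [apply/ffun_onP|apply/forallP].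
rewrite big_split /= -rmorph_prod prodrXr /= coefCM coefXn [n == _]eq_sym.
by case: ifP; rewrite ?mulr1 ?mulr0.
Qed.

Lemma c1_cut_count m k : c1 (m + k) k = cut_count k m.
Proof.
case: k => [|k].
  by rewrite c1_coef_exp expr0 coef1 natn addn0 cut_count0n.
rewrite c1_coef_exp exprMn coefXnM ltnNge leq_addl addnK.
by rewrite coef_word_poly_exp // addnS ltnS leq_addr.
Qed.

(** Vandermonde's identity, with [i] the number of nonempty pieces: they are
    chosen among the [k] pieces, and then [j] blocks are cut into [i] nonempty
    pieces. *)
Lemma bin_nonempty_pieces k j : 0 < j ->
  'C(k + j - 1, j) = \sum_(1 <= i < k.+1) 'C(k, i) * 'C(j - 1, i - 1).
Proof.
case: j k => [//|j] [|k] _; first by rewrite bin_small ?big_geq //; lia.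
have -> : k.+1 + j.+1 - 1 = j + k.+1 by lia.
rewrite -bin_sub; last by lia.
have -> : j + k.+1 - j.+1 = k by lia.
(* The left side is now ['C(j + k.+1, k)], so the sum has exactly [k.+1] terms. *)
rewrite -Vandermonde big_add1 big_mkord; apply: eq_bigr => i _.
by rewrite mulnC !subn1 /= -(bin_sub (ltn_ord i)) subSS.
Qed.

Theorem proposition12 :
  (forall k : nat, 1 <= k -> c1 k k = 1) /\
  (forall n k : nat, 1 <= k -> k < n ->
     c1 n k = \sum_(1 <= i < k.+1) \sum_(i <= j < ((n - k) %/ 2).+1)
                'C(k, i) * 'C(j - 1, i - 1) * 'C(n - k - j - 1, j - 1)).
Proof.
split=> [k _|n k _ lt_kn]; first by rewrite -[k in c1 k]add0n c1_cut_count cut_countn0.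
rewrite -[n in LHS](subnK (ltnW lt_kn)) c1_cut_count.
have : 0 < n - k by rewrite subn_gt0.
move: (n - k) => m m_gt0 {n lt_kn}.
(* [m] letters contain at least 1 and at most [m %/ 2] blocks. *)
have -> : cut_count k m = \sum_(1 <= j < (m %/ 2).+1) 'C(k + j - 1, j) * comp2 m j.
  rewrite /cut_count -(big_mkord xpredT (fun j => 'C(k + j - 1, j) * comp2 m j)).
  rewrite big_ltn // {1}(_ : comp2 m 0 = 0) ?muln0 ?add0n; last by case: m m_gt0 => [|[]].
  rewrite (big_cat_nat (n := (m %/ 2).+1)) //=; last by lia.
  rewrite [X in _ + X]big_nat_cond [X in _ + X]big1 ?addn0 // => j /andP[/andP[lt_j _] _].
  by rewrite comp2_large ?muln0 //; lia.
(* [j] blocks cannot be cut into [i > j] nonempty pieces, so [j] can start at 1. *)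
have widen i : 1 <= i ->
    \sum_(i <= j < (m %/ 2).+1) 'C(k, i) * 'C(j - 1, i - 1) * 'C(m - j - 1, j - 1) =
    \sum_(1 <= j < (m %/ 2).+1) 'C(k, i) * 'C(j - 1, i - 1) * 'C(m - j - 1, j - 1).
  move=> i_gt0; rewrite [in LHS](big_nat_widenl _ 1) // big_mkcond big_nat [RHS]big_nat.
  apply: eq_bigr => j /andP[j_gt0 _]; case: leqP => //= lt_ji.
  by rewrite (@bin_small (j - 1)) ?muln0 //; lia.
rewrite [RHS]big_nat; under [RHS]eq_bigr => i /andP[i_gt0 _] do rewrite widen //.
rewrite -big_nat exchange_big_nat [LHS]big_nat [RHS]big_nat /=.
apply: eq_bigr => j /andP[j_gt0 le_j].
rewrite comp2_bin ?bin_nonempty_pieces ?big_distrl //; lia.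
Qed.
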